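(* Let $X$ and $Y$ be metric spaces and let $f:X\to Y$ be a continuous open-$(LC_1\cup F)$ map. Then $f$ can be decomposed into the union of one open map and two closed maps: there exist subsets $X_1,X_2,X_3\subseteq X$ with $X=X_1\cup X_2\cup X_3$ such that $f|_{X_1}:X_1\to f(X_1)$ is an open map and $f|_{X_2}:X_2\to f(X_2)$ and $f|_{X_3}:X_3\to f(X_3)$ are closed maps.
   Context: A subset of $Y$ is an $LC_1$ set if it is the intersection of an open subset and a closed subset of $Y$. A subset of $Y$ is an $LC_1\cup F$ set if it is the union of an $LC_1$ set and a closed subset of $Y$. A map $f:X\to Y$ is open-$(LC_1\cup F)$ if the image $f(V)$ of every open set $V\subseteq X$ is an $LC_1\cup F$ set in $Y$. Subsets carry the subspace topology; the pieces $X_i$ are arbitrary, possibly empty. A map is open (closed) if it takes open (closed) subsets of its domain to open (closed) subsets of its codomain. *)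

(* Defs.v *)
From HB Require Import structures.
From mathcomp Require Import all_boot all_order all_algebra.
From mathcomp Require Import all_classical all_reals all_analysis.

Set Implicit Arguments.
Unset Strict Implicit.
Unset Printing Implicit Defensive.

Local Open Scope classical_set_scope.

Section LC_sets.
Context {T : topologicalType}.

Definition LC1 (A : set T) : Prop :=
  exists U C : set T, [/\ open U, closed C & A = U `&` C].

Definition LC1_F (A : set T) : Prop :=
  exists L F : set T, [/\ LC1 L, closed F & A = L `|` F].

End LC_sets.

Section maps.
Context {X Y : topologicalType}.

Definition open_LC1_F (f : X -> Y) : Prop :=
  forall V : set X, open V -> LC1_F (f @` V).

Definition open_map (f : X -> Y) : Prop :=
  forall V : set X, open V -> open (f @` V).

Definition closed_map (f : X -> Y) : Prop :=
  forall C : set X, closed C -> closed (f @` C).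

End maps.

(* The restriction f|_A : A -> f(A), between the subtypes [set_type A] and
   [set_type (f @` A)], which carry the topology induced by the inclusion. *)
Definition restr_img {X Y : Type} (f : X -> Y) (A : set X) : A -> f @` A :=
  sigLR [fun f in A].
Arguments restr_img {X Y} f A _.

(* Main.v *)
Require Import Defs.
From mathcomp Require Import all_boot all_order all_algebra.
From mathcomp Require Import all_classical all_reals all_analysis.

Import Order.TTheory GRing.Theory Num.Theory.

(** Let [Z] be the image of [f].  All the difficulty sits over a discrete set.
    Over the isolated points of [Z] the image is discrete, and any map onto a
    discrete space is closed.  At a limit point [f x] of [Z], call [x] bad if
    some neighbourhood [V] of [x] has an image that misses points arbitrarily
    close to [f x] which are themselves limit points of [Z].  The set [B] of the
    values of [f] at bad points has no limit point at all
    ([nonopen_points_discrete]), so the map is again closed over [B].  What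
    remains, the part of [X] over the limit points of [Z] outside [B], is a union
    of fibres without bad points, and there [f] is open onto its image.

    The discreteness of [B] is where the hypothesis on images of open sets
    enters.  An [LC_1 \cup F] set [A] lies at the third level of the difference
    hierarchy over closed sets, so it cannot alternate too often: a point outside
    [A] is not a limit of points of [A] which are limits of points outside [A]
    which are in turn limits of points of [A] ([LC1_F_alternation]).  If [B] had a
    limit point [y], such an alternation would be realised by the image of an
    open set.  Choose points [p] of [B] tending to [y], with disjoint
    neighbourhoods [W p].  Badness at a point over [p] gives an open [V p] and
    points [q] of [W p] tending to [p], missed by [f @` V p], each of which is a
    limit point of [Z].  Over [W p], take the union of [V p] and of everything
    not lying over [p] or over one of the [q].  The image of the resulting open
    set omits [y], contains every [p], omits every [q], and accumulates at every
    [q] because [q] is a limit of other points of [Z].  The points [p] and [q]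
    have to be selected sparsely enough for the sets to remain open, which is the
    purpose of [limit_point_sequence]. *)

Local Open Scope classical_set_scope.

(** Write [A] as [(U `&` C) `|` F] with [U] open and [C], [F] closed.  Off [F],
    points of [A] lie in [U `&` C]; nearby points outside [A] are still in [U],
    hence outside the closed set [C], and so cannot be limits of [A]. *)
Lemma LC1_F_alternation {T : topologicalType} {A : set T} :
  LC1_F A -> closure (A `&` closure (~` A `&` closure A)) `<=` A.
Proof.
move=> [_ [F [[U [C [oU cC ->]]] cF ->]]] y; apply: contraPP => nAy cly.
have oF : open (~` F) by exact: closed_openC.
have /cly[p [[[[Up Cp]|//] clp] nFp]] : nbhs y (~` F).
  by apply: open_nbhs_nbhs; split=> // Fy; apply: nAy; right.
have /clp[q [[nAq clq] [Uq nFq]]] : nbhs p (U `&` ~` F).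
  by apply: open_nbhs_nbhs; split=> //; exact: openI.
have nCq : ~ C q by move=> Cq; apply: nAq; left.
have /clq[z [[[_ Cz]|Fz] [nCz nFz]]] // : nbhs q (~` C `&` ~` F).
by apply: open_nbhs_nbhs; split=> //; apply: openI => //; exact: closed_openC.
Qed.

Lemma metric_closed1 (R : realType) (Y : metricType R) (y : Y) :
  closed [set y].
Proof. exact/accessible_closed_set1/hausdorff_accessible/metric_hausdorff. Qed.

(** [D] is the range of a sequence in [P] that tends to [y] while avoiding it; near
    any other point only finitely many of its terms matter, and a finite set is
    closed. *)
Lemma limit_point_sequence {R : realType} {Y : metricType R} {P : set Y}
    {y : Y} :
  limit_point P y ->
  exists D : set Y, [/\ D `<=` P, ~ D y, closure D y &
    forall z, z != y -> ~ limit_point D z].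
Proof.
move=> Py.
have near_y n : exists p, [/\ p != y, P p & ball y (n.+1%:R^-1 : R)%R p].
  by apply: Py; apply: nbhsx_ballx; rewrite invr_gt0 ltr0Sn.
have [p pP] := choice near_y.
exists (range p); split.
- by move=> _ [n _ <-]; have [] := pP n.
- by move=> [n _ pny]; have [] := pP n; rewrite pny eqxx.
- move=> V /nbhs_ballP[e /= e0 eV].
  have [n _ /(_ n (leqnn n)) ne] := near_infty_natSinv_lt (PosNum e0).
  exists (p n); split; first by exists n.
  by apply: eV; have [_ _] := pP n; apply: le_ball; exact: ltW.
- move=> z zy lz.
  (* Only the first [N] terms can lie farther than [d] from [y], and the balls of
     radius [d] around [y] and [z] are disjoint. *)
  pose d := (mdist z y / 2)%R.
  have d0 : (0 < d)%R by rewrite divr_gt0 ?mdist_gt0.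
  have [N _ Nd] := near_infty_natSinv_lt (PosNum d0).
  pose K := (p @` `I_N) `\ z.
  have cK : closed K.
    have /accessible_finite_set_closed :=
      hausdorff_accessible (@metric_hausdorff _ Y).
    apply; apply: finite_setD; apply: finite_image; exact: finite_II.
  have : nbhs z (ball z d `&` ~` K).
    apply: filterI; first exact: nbhsx_ballx.
    by apply: open_nbhs_nbhs; split; [exact: closed_openC|move=> [_]; exact].
  move=> /lz[q [qz [n _ pnq] []]]; rewrite -{}pnq in qz * => zp nK.
  have [nN|Nn] := ltnP n N.
    by apply: nK; split; [exists n|exact/eqP].
  have [_ _ yp] := pP n.
  have {}yp : ball y d (p n) by apply: le_ball yp; apply: ltW; exact: Nd.
  have := ball_triangle zp (ball_sym yp).
  by rewrite -splitr ballEmdist /= ltxx.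
Qed.

(** Halving the radii of balls that isolate the points of [D] makes the balls
    disjoint: a common point of two of them would put the centre of one within
    the larger of the two original radii of the other. *)
Lemma disjoint_open_nbhs {R : realType} {Y : metricType R} {D : set Y} :
  (forall p, D p -> ~ limit_point D p) ->
  exists W : Y -> set Y,
    (forall p, open_nbhs p (W p)) /\ trivIset D W.
Proof.
move=> Ddisc.
have sep p : exists r : R, (0 < r)%R /\
    (D p -> forall q, D q -> ball p r q -> q = p).
  have [Dp|nDp] := pselect (D p); last by exists 1%R.
  have /existsNP[U /not_implyP[/nbhs_ballP[r /= r0 rU] nU]] := Ddisc p Dp.
  exists r; split=> // _ q Dq pq; apply: contrapT => /eqP qp.
  by apply: nU; exists q; split=> //; exact: rU.
have [r rP] := choice sep.
exists (fun p => interior (ball p (r p / 2)%R)); split.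
  move=> p; split; first exact: open_interior.
  by apply: nbhsx_ballx; rewrite divr_gt0 //; case: (rP p).
move=> p q Dp Dq [z [/interior_subset zp /interior_subset zq]].
wlog pq : p q Dp Dq zp zq / (r p <= r q)%R.
  by move=> h; case/orP: (le_total (r p) (r q)) => ?; [|symmetry]; exact: h.
have [rq0 /(_ Dq)] := rP q; apply => //.
apply: (ball_splitr (z := z)); apply: ball_sym => //.
by apply: le_ball zp; rewrite ler_pM2r ?invr_gt0.
Qed.

Section nonopen.
Context {R : realType} {X : topologicalType} {Y : metricType R} (f : X -> Y).

(** The points at which [f] fails to be open when only the values in [S] are
    taken into account. *)
Definition nonopen_points (S : set Y) : set X :=
  [set x | exists2 V, open_nbhs x V & closure (S `\` f @` V) (f x)].

(** A limit point [y] of these values would yield an open set [G] whose image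
    alternates at [y] in the way excluded by [LC1_F_alternation].  Because [S]
    consists of limit points of the range, the points that [f @` G] is made to
    omit can still be approached by [f @` G]. *)
Lemma nonopen_points_discrete (S : set Y) (y : Y) :
  continuous f -> open_LC1_F f -> S `<=` limit_point (range f) ->
  ~ limit_point (f @` nonopen_points S) y.
Proof.
move=> f_cont f_LC SZ /limit_point_sequence[D [DB nDy clD Dlim]].
have Dy p : D p -> p != y by move=> Dp; apply: contra_notN nDy => /eqP <-.
have [W0 [oW0 tW0]] := disjoint_open_nbhs (fun p Dp => Dlim p (Dy p Dp)).
(* Removing [y] from the neighbourhoods keeps [y] out of [f @` G] below. *)
pose W p := W0 p `\ y.
have oW p : open (W p).
  apply: openI; first by case: (oW0 p).
  by apply: closed_openC; exact: metric_closed1.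
have Wp p : D p -> W p p.
  by move=> Dp; split; [case: (oW0 p)|exact/eqP/Dy].
have tW : trivIset D W.
  by move=> p q Dp Dq [z [[pz _] [qz _]]]; apply: tW0 => //; exists z.
(* For [p] in [D]: [VE.1] is an open set witnessing the failure of openness, and
   [VE.2] is a sequence of missed values that tends to [p] inside [W p]. *)
have data p : exists VE : set X * set Y, D p ->
    [/\ open VE.1, (f @` VE.1) p & [/\ VE.2 `<=` (S `\` f @` VE.1) `&` W p,
     closure VE.2 p & forall z, z != p -> ~ limit_point VE.2 z]].
  have [Dp|nDp] := pselect (D p); last by exists (set0, set0).
  have [x [V [oV Vx] clV] fxp] := DB p Dp; rewrite fxp in clV.
  have [|E [EV nEp clE Elim]] :=
      @limit_point_sequence _ _ ((S `\` f @` V) `&` W p) p.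
    move=> U Up; have /clV[z [[Sz nVz] [Uz Wz]]] : nbhs p (U `&` W p).
      by apply: filterI => //; apply: open_nbhs_nbhs; split => //; exact: Wp.
    exists z; split=> //; apply: contra_notN nVz => /eqP ->.
    by exists x.
  exists (V, E) => _; split=> //=; first by exists x.
have {data}[VE VEP] := choice data.
pose V p := (VE p).1; pose E p := (VE p).2.
(* The only limit point of [E p] is [p]. *)
have oE p : D p -> open (~` (p |` E p)).
  move=> Dp; apply: closed_openC => z clz.
  have [->|zp] := eqVneq z p; [by left|right].
  have [_ _ [_ _ /(_ z zp) Elim]] := VEP p Dp.
  move: clz; rewrite closureU => -[/metric_closed1 zep|].
    by move: zp; rewrite zep eqxx.
  by rewrite closure_isolated_limit_point => -[/isolatedS|].
pose G := \bigcup_(p in D)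
  (f @^-1` (W p) `&` (V p `|` f @^-1` (~` (p |` E p)))).
have opre O : open O -> open (f @^-1` O) by move=> oO; apply: open_comp.
have oG : open G.
  apply: bigcup_open => p Dp; have [oV _ _] := VEP p Dp.
  apply: openI; last by apply: openU => //; exact/opre/oE.
  exact: opre.
have Gp p : D p -> (f @` G) p.
  move=> Dp; have [_ [x Vx fxp] _] := VEP p Dp.
  exists x => //; exists p => //.
  by rewrite /preimage /= fxp; split; [exact: Wp|left].
have GE p q : D p -> E p q -> ~ (f @` G) q.
  move=> Dp Eq [x [p' Dp' [Wx xV]] fxq]; subst q.
  have [_ _ [sub _ _]] := VEP p Dp; have [[_ nVq] Wq] := sub _ Eq.
  have pp' : p = p' by apply: tW => //; exists (f x).
  case: xV => [Vx|]; first by apply: nVq; exists x => //; rewrite /= pp'.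
  by apply; right; rewrite -pp'.
have clGE p q : D p -> E p q -> closure (f @` G) q.
  move=> Dp Eq U Uq.
  have [_ _ [sub _ Elim]] := VEP p Dp; have [[Sq nVq] Wq] := sub q Eq.
  have qp : q != p by apply: contra_notN (GE p q Dp Eq) => /eqP ->; exact: Gp.
  have /existsNP[U' /not_implyP[U'q nU']] := Elim q qp.
  (* [q] is a limit point of the range and isolated in [E p], so the values of
     [f] close to [q] and distinct from it are not in [E p]. *)
  have : nbhs q (U `&` U' `&` (W p `&` ~` [set p])).
    apply: filterI; [exact: filterI|apply: open_nbhs_nbhs; split].
      by apply: openI => //; apply: closed_openC; exact: metric_closed1.
    by split=> //; exact/eqP.
  move=> /(SZ _ Sq)[z [zq [x _ fxz]]]; subst z => -[[Uz U'z] [Wz zp]].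
  exists (f x); split=> //; exists x => //; exists p => //; split=> //; right.
  by move=> [//|Ez]; apply: nU'; exists (f x).
(* The alternation: [y] is a limit of [D], whose points [p] are limits of
   [E p], whose points are limits of [f @` G]. *)
have : closure (f @` G `&` closure (~` (f @` G) `&` closure (f @` G))) y.
  apply: closureS clD => p Dp; split; first exact: Gp.
  have [_ _ [_ clE _]] := VEP p Dp.
  by apply: closureS clE => q Eq; split; [exact: GE Eq|exact: clGE Eq].
move/(LC1_F_alternation (f_LC _ oG)) => [x [p Dp [[_ fxNy] _]] fxy].
exact: fxNy.
Qed.

End nonopen.

(** Openness of the restriction, expressed in the ambient spaces. *)
Lemma open_map_restr_img {X Y : topologicalType} {f : X -> Y} {A : set X} :
  (forall x V, A x -> open_nbhs x V ->
     exists2 Q, open_nbhs (f x) Q & Q `&` f @` A `<=` f @` (V `&` A)) ->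
  open_map (restr_img f A).
Proof.
move=> fA _ [V oV <-]; rewrite openE => _ [a Va <-].
have xA := set_mem (valP a).
have [Q [oQ Qfa] sub] := fA _ V xA (conj oV Va).
rewrite /interior nbhsE; exists (set_val @^-1` Q); first by split=> //; exists Q.
move=> b Qb.
have [x [Vx Ax] fxb] : (f @` (V `&` A)) (set_val b).
  by apply: sub; split=> //; exact: set_mem (valP b).
by exists (SigSub (mem_set Ax)) => //; apply: val_inj.
Qed.

(** Every subset of a discrete space is closed. *)
Lemma closed_map_restr_img {X Y : topologicalType} {f : X -> Y} {A : set X} :
  (forall y, (f @` A) y -> ~ limit_point (f @` A) y) ->
  closed_map (restr_img f A).
Proof.
move=> fA C _ b clb.
have /existsNP[U /not_implyP[]] := fA _ (set_mem (valP b)).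
rewrite nbhsE => -[Q [oQ Qb] QU] nU.
have /clb[c [Cc Qc]] : nbhs b (set_val @^-1` Q).
  by apply: open_nbhs_nbhs; split=> //; exists Q.
suff <- : c = b by [].
apply: val_inj; apply: contrapT => /eqP cb; apply: nU.
by exists (val c); split=> //; [exact: set_mem (valP c)|exact: QU].
Qed.

Theorem theorem2 (R : realType) (X Y : metricType R) (f : X -> Y)
    (f_cont : continuous f) (f_LC : open_LC1_F f) :
  exists X1 X2 X3 : set X,
    [/\ [set: X] = X1 `|` X2 `|` X3,
        open_map (restr_img f X1),
        closed_map (restr_img f X2) &
        closed_map (restr_img f X3)].
Proof.
pose Z := range f; pose S := Z `&` limit_point Z.
pose B := f @` nonopen_points f S.
have Bdisc y : ~ limit_point B y.
  by apply: nonopen_points_discrete => // z [].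
exists (f @^-1` (limit_point Z `\` B)), (f @^-1` B),
  (f @^-1` (~` limit_point Z)); split.
- apply/seteqP; split=> // x _.
  have [Bx|nBx] := pselect (B (f x)); first by left; right.
  by have [Zx|nZx] := pselect (limit_point Z (f x)); [left; left|right].
- apply: open_map_restr_img => x V [Zx nBx] xV.
  exists (~` closure (S `\` f @` V)).
    split; first exact/closed_openC/closed_closure.
    by move=> clx; apply: nBx; exists x => //; exists V.
  (* The part of [X] considered here is a union of fibres, so a preimage in [V]
     of a value of the restriction already lies in it. *)
  move=> w [nclz [z [Zz nBz] fzw]]; subst w.
  have [t Vt ftz] : (f @` V) (f z).
    apply: contrapT => nVz; apply: nclz; apply: subset_closure.
    by split=> //; split=> //; exists z.
  by exists t => //; split=> //; rewrite /preimage /= ftz.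
- apply: closed_map_restr_img => y _ ly; apply: (Bdisc y) => U /ly.
  by move=> [z [zy [x Bx fxz] Uz]]; exists z; split=> //; rewrite -fxz.
- apply: closed_map_restr_img => _ [x nZx <-] lx; apply: nZx => U /lx.
  by move=> [z [zx [t _ ftz] Uz]]; exists z; split=> //; exists t.
Qed.
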